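(* Let $\beta_c=\log 4$ and let $\beta>\beta_c$. Then there exists a critical value $K_c^{(1)}(\beta)>0$ such that the following hold. (a) (i) For $0<K<K_c^{(1)}(\beta)$, $\mathcal{E}_{\beta,K}=\{\rho_\beta\}$. (ii) For $K=K_c^{(1)}(\beta)$, there exist probability measures $\nu^+(\beta,K_c^{(1)}(\beta))$ and $\nu^-(\beta,K_c^{(1)}(\beta))$ in $\mathcal{P}(\Lambda)$ such that $\nu^+(\beta,K_c^{(1)}(\beta))$, $\nu^-(\beta,K_c^{(1)}(\beta))$, $\rho_\beta$ are pairwise distinct and $\mathcal{E}_{\beta,K}=\{\rho_\beta,\nu^+(\beta,K_c^{(1)}(\beta)),\nu^-(\beta,K_c^{(1)}(\beta))\}$. (iii) For $K>K_c^{(1)}(\beta)$, there exist probability measures $\nu^+(\beta,K)$ and $\nu^-(\beta,K)$ in $\mathcal{P}(\Lambda)$ such that $\nu^+(\beta,K)$, $\nu^-(\beta,K)$, $\rho_\beta$ are pairwise distinct and $\mathcal{E}_{\beta,K}=\{\nu^+(\beta,K),\nu^-(\beta,K)\}$. (b) If we write $\nu^+(\beta,K)=\nu^+_{-1}\delta_{-1}+\nu^+_0\delta_0+\nu^+_1\delta_1$, then $\nu^-(\beta,K)=\nu^+_{1}\delta_{-1}+\nu^+_0\delta_0+\nu^+_{-1}\delta_1$. (c) For each choice of sign, $\nu^{\pm}(\beta,K)$ is a continuous function of $K$ for $K\ge K_c^{(1)}(\beta)$, and $\nu^{\pm}(\beta,K)\to\nu^{\pm}(\beta,K_c^{(1)}(\beta))\ne\rho_\beta$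 as $K\to (K_c^{(1)}(\beta))^+$. (In this sense $\mathcal{E}_{\beta,K}$ exhibits a discontinuous bifurcation at $K_c^{(1)}(\beta)$.)
   Context: Let $\Lambda=\{-1,0,1\}$ and let $\mathcal{P}(\Lambda)$ be the set of probability measures on $\Lambda$; each $\mu\in\mathcal{P}(\Lambda)$ is written $\mu=\mu_{-1}\delta_{-1}+\mu_0\delta_0+\mu_1\delta_1$ and $\mathcal{P}(\Lambda)$ is topologized as a subset of $\mathbb{R}^3$ (probability vectors). Let $\rho=\frac13(\delta_{-1}+\delta_0+\delta_1)$. The relative entropy is $R(\mu|\rho)=\sum_{i=-1}^1\mu_i\log(3\mu_i)$ (with $0\log 0=0$). For $K>0$ define $$f_K(\mu)=\int_\Lambda y^2\mu(dy)-K\Big(\int_\Lambda y\,\mu(dy)\Big)^2=(\mu_1+\mu_{-1})-K(\mu_1-\mu_{-1})^2 .$$ For $\beta>0$, $K>0$, the set of canonical equilibrium macrostates is $$\mathcal{E}_{\beta,K}=\{\nu\in\mathcal{P}(\Lambda):\nu\text{ minimizes }R(\nu|\rho)+\beta f_K(\nu)\text{ over }\mathcal{P}(\Lambda)\}.$$ The measure $\rho_\beta\in\mathcal{P}(\Lambda)$ is $\rho_\beta(dy)=\frac{1}{Z(\beta)}e^{-\beta y^2}\rho(dy)$ with $Z(\beta)=\int_\Lambda e^{-\beta y^2}\rho(dy)$. *)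

(* Defs.v *)
From Stdlib Require Import Reals.
From Coquelicot Require Import Coquelicot.
Open Scope R_scope.

Inductive Lambda : Set := Lneg | Lzero | Lpos.

Definition spin (i : Lambda) : R :=
  match i with Lneg => -1 | Lzero => 0 | Lpos => 1 end.

Definition sum_Lambda (F : Lambda -> R) : R := F Lneg + F Lzero + F Lpos.

(* A measure on Lambda is its vector of point masses [i |-> mu_i].  Since Lambda
   is finite, Coquelicot's uniform structure on [Lambda -> R] is the one of the
   sup norm on R^3. *)
Definition is_prob (mu : Lambda -> R) : Prop :=
  (forall i, 0 <= mu i) /\ sum_Lambda mu = 1.

Definition integral (mu : Lambda -> R) (g : R -> R) : R :=
  sum_Lambda (fun i => g (spin i) * mu i).

Definition rho : Lambda -> R := fun _ => / 3.

(* R(mu | rho); the convention 0 log 0 = 0 holds because [ln 0] is a real number. *)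
Definition rel_entropy (mu : Lambda -> R) : R :=
  sum_Lambda (fun i => mu i * ln (3 * mu i)).

Definition f (K : R) (mu : Lambda -> R) : R :=
  integral mu (fun y => y ^ 2) - K * (integral mu (fun y => y)) ^ 2.

Definition macrostates (beta K : R) (nu : Lambda -> R) : Prop :=
  is_prob nu /\
  forall mu, is_prob mu ->
    rel_entropy nu + beta * f K nu <= rel_entropy mu + beta * f K mu.

Definition Z (beta : R) : R := integral rho (fun y => exp (- beta * y ^ 2)).

Definition rho_beta (beta : R) : Lambda -> R :=
  fun i => / Z beta * exp (- beta * spin i ^ 2) * rho i.

Definition flip (i : Lambda) : Lambda :=
  match i with Lneg => Lpos | Lzero => Lzero | Lpos => Lneg end.

(* Main.v *)
(* The relative entropy with respect to the tilted measure [gibbs beta t] (density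
   proportional to exp(- beta y^2 + t y)) is nonnegative, which linearises the
   quadratic term of the energy: the equilibrium macrostates are exactly the
   [gibbs beta t] with [t] a global minimizer of t^2 / (4 beta K) - c(t), where
   c(t) = log(1 + 2 a cosh t) up to a constant and a = exp(- beta).

   When a < 1/4 the derivative c' is convex, then concave, on the positive axis, so
   [slope] c'(t) / t first increases and then decreases.  The critical points solve
   slope(t) = 1 / (2 beta K), and the nonzero global minimizer lies on the decreasing
   branch.  The critical K is the one for which its energy equals that at 0, namely
   K = 1 / (2 beta slope(T)) where t c'(t) - 2 (c(t) - c(0)) vanishes at T > 0. *)
Require Import Defs.
From Stdlib Require Import Reals Ranalysis5 Lra FunctionalExtensionality ClassicalEpsilon.
From Coquelicot Require Import Coquelicot.
Open Scope R_scope.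

(** * Monotonicity and sign changes read off a derivative *)

Lemma mvt (F F' : R -> R) (x y : R) :
  x < y -> (forall t, x <= t <= y -> is_derive F t (F' t)) ->
  exists c, F y - F x = F' c * (y - x) /\ x < c < y.
Proof.
intros hxy hF. apply MVT_cor2; [exact hxy|].
intros c hc. apply is_derive_Reals. auto.
Qed.

Lemma strict_incr (F F' : R -> R) (x y : R) :
  x < y -> (forall t, x <= t <= y -> is_derive F t (F' t)) ->
  (forall t, x < t < y -> 0 < F' t) -> F x < F y.
Proof.
intros hxy hF hpos. destruct (mvt F F' x y hxy hF) as [c [e hc]].
specialize (hpos c hc). nra.
Qed.

Lemma strict_decr (F F' : R -> R) (x y : R) :
  x < y -> (forall t, x <= t <= y -> is_derive F t (F' t)) ->
  (forall t, x < t < y -> F' t < 0) -> F y < F x.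
Proof.
intros hxy hF hneg. destruct (mvt F F' x y hxy hF) as [c [e hc]].
specialize (hneg c hc). nra.
Qed.

Lemma zero_crossing (F F' : R -> R) (x y : R) :
  x < y -> (forall t, x <= t <= y -> is_derive F t (F' t)) ->
  0 < F x -> F y < 0 -> exists z, x < z < y /\ F z = 0.
Proof.
intros hxy hF hx hy.
destruct (IVT_interv (fun t => - F t) x y) as [z [hz e]]; try lra.
- intros t ht. apply continuity_pt_filterlim.
  apply (ex_derive_continuous (fun t => - F t)).
  exists (- F' t). apply (is_derive_opp F). auto.
- exists z. assert (F z = 0) by lra. split; [|assumption].
  destruct (Req_dec z x); [subst; lra|]. destruct (Req_dec z y); [subst; lra|]. lra.
Qed.

(** The function climbs from 0 until [c] and falls strictly afterwards, so a negative value can only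
    lie beyond [c], and the intermediate value theorem gives the single sign change. This lifts a
    plus-then-minus pattern from a derivative to its primitive. *)
Lemma zero_after_peak (F F' : R -> R) (c y : R) :
  0 < c -> (forall t, is_derive F t (F' t)) -> F 0 = 0 ->
  (forall t, 0 < t < c -> 0 < F' t) -> (forall t, c < t -> F' t < 0) ->
  0 < y -> F y < 0 ->
  exists z, c < z /\ F z = 0 /\ (forall t, 0 < t < z -> 0 < F t) /\
    (forall t, z < t -> F t < 0).
Proof.
intros hc hF h0 hup hdown hy hFy.
assert (up : forall t, 0 < t <= c -> 0 < F t).
{ intros t ht. rewrite <- h0. apply (strict_incr F F'); [lra|auto|].
  intros s hs. apply hup. lra. }
assert (down : forall s t, c <= s < t -> F t < F s).
{ intros s t hst. apply (strict_decr F F'); [lra|auto|].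
  intros u hu. apply hdown. lra. }
assert (hcy : c < y).
{ destruct (Rlt_le_dec c y); [assumption|]. specialize (up y). lra. }
destruct (zero_crossing F F' c y hcy) as [z [hz e]]; auto.
{ apply up. lra. }
exists z. split; [lra|]. split; [exact e|]. split.
- intros t ht. destruct (Rle_lt_dec t c) as [htc|htc]; [apply up; lra|].
  rewrite <- e. apply down. lra.
- intros t ht. rewrite <- e. apply down. lra.
Qed.

(** * The tilted partition function and its cumulants *)

(** For [a = exp (- beta)] this is the sum of exp(- beta y^2 + t y) over y in {-1, 0, 1}, the
    normalising constant of the tilted measure. *)
Definition partition (a t : R) : R := 1 + 2 * a * cosh t.

Definition cgf (a t : R) : R := ln (partition a t) - ln (partition a 0).

Definition mean (a t : R) : R := 2 * a * sinh t / partition a t.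

Definition variance (a t : R) : R :=
  (partition a t - 1 + 4 * a ^ 2) / partition a t ^ 2.

(** The third cumulant of the tilted measure, not divided by a power of the variance. *)
Definition skewness (a t : R) : R :=
  2 * a * sinh t * (2 - 8 * a ^ 2 - partition a t) / partition a t ^ 3.

Lemma cosh_sinh_sqr (t : R) : cosh t ^ 2 = 1 + sinh t ^ 2.
Proof.
unfold cosh, sinh. rewrite exp_Ropp. field. apply Rgt_not_eq, exp_pos.
Qed.

Lemma cosh_pos (t : R) : 0 < cosh t.
Proof. unfold cosh. generalize (exp_pos t) (exp_pos (- t)). lra. Qed.

Lemma sinh_pos (t : R) : 0 < t -> 0 < sinh t.
Proof. intro ht. rewrite <- sinh_0. apply sinh_lt, ht. Qed.

Lemma is_derive_cosh (t : R) : is_derive cosh t (sinh t).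
Proof. apply is_derive_Reals, derivable_pt_lim_cosh. Qed.

Lemma is_derive_sinh (t : R) : is_derive sinh t (cosh t).
Proof. apply is_derive_Reals, derivable_pt_lim_sinh. Qed.

Lemma partition_pos (a t : R) : 0 < a -> 0 < partition a t.
Proof. intro ha. unfold partition. generalize (cosh_pos t). nra. Qed.

Lemma partition_0 (a : R) : partition a 0 = 1 + 2 * a.
Proof. unfold partition. rewrite cosh_0. ring. Qed.

Lemma cgf_0 (a : R) : cgf a 0 = 0.
Proof. unfold cgf. ring. Qed.

Lemma partition_opp (a t : R) : partition a (- t) = partition a t.
Proof. unfold partition, cosh. rewrite Ropp_involutive. field. Qed.

Lemma is_derive_partition (a t : R) :
  is_derive (partition a) t (2 * a * sinh t).
Proof.
unfold partition. evar_last.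
- apply @is_derive_plus; [apply is_derive_const|].
  apply is_derive_scal, is_derive_cosh.
- unfold plus, zero; simpl. ring.
Qed.

Lemma is_derive_cgf (a t : R) : 0 < a -> is_derive (cgf a) t (mean a t).
Proof.
intro ha. generalize (partition_pos a t ha); intro hN. unfold cgf.
generalize (is_derive_partition a t); intro hd.
auto_derive.
- split; [exists (2 * a * sinh t); exact hd|auto].
- rewrite (is_derive_unique (fun x : R => partition a x) _ _ hd). unfold mean. field. lra.
Qed.

Lemma is_derive_mean (a t : R) : 0 < a -> is_derive (mean a) t (variance a t).
Proof.
intro ha. generalize (partition_pos a t ha); intro hN. unfold mean.
evar_last.
- apply is_derive_div; [apply is_derive_scal, is_derive_sinh
  |apply is_derive_partition|lra].
- generalize (cosh_sinh_sqr t); intro e.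
  unfold variance, partition in *. apply Rminus_diag_uniq.
  replace (sinh t * (2 * a * sinh t)) with (2 * a * (sinh t ^ 2)) by ring.
  replace (2 * a * sinh t * (2 * a * sinh t))
    with (4 * a ^ 2 * (cosh t ^ 2 - 1)) by (rewrite e; ring).
  field. lra.
Qed.

Lemma is_derive_variance (a t : R) :
  0 < a -> is_derive (variance a) t (skewness a t).
Proof.
intro ha. generalize (partition_pos a t ha); intro hN. unfold variance.
generalize (is_derive_partition a t); intro hd.
auto_derive.
- repeat split; try (exists (2 * a * sinh t); exact hd).
  apply Rgt_not_eq. nra.
- rewrite (is_derive_unique (fun x : R => partition a x) _ _ hd). unfold skewness. field. lra.
Qed.

(** * Growth bounds and sign patterns of the gap functions *)

Lemma mean_pos (a t : R) : 0 < a -> 0 < t -> 0 < mean a t.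
Proof.
intros ha ht. unfold mean. generalize (sinh_pos t ht) (partition_pos a t ha); intros.
apply Rdiv_lt_0_compat; nra.
Qed.

Lemma mean_lt_1 (a t : R) : 0 < a -> mean a t < 1.
Proof.
intro ha. unfold mean. generalize (partition_pos a t ha); intro hN.
apply Rlt_div_l; [exact hN|]. unfold partition, cosh, sinh.
generalize (exp_pos (- t)). nra.
Qed.

(** Only the term a exp(t) of the partition function is kept. *)
Lemma cgf_lower (a t : R) : 0 < a -> t + ln (a / (1 + 2 * a)) <= cgf a t.
Proof.
intro ha. unfold cgf. rewrite partition_0, ln_div; try lra.
assert (e : ln (exp t * a) <= ln (partition a t)).
{ generalize (exp_pos t) (exp_pos (- t)); intros.
  apply Rcomplements.ln_le; [nra|]. unfold partition, cosh. nra. }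
rewrite ln_mult, ln_exp in e; [lra|apply exp_pos|exact ha].
Qed.

(* Up to a positive factor, the derivatives of [mean a t / t] and of
   [cgf a t / t ^ 2]. *)
Definition slope_gap (a t : R) : R := t * variance a t - mean a t.

Definition chord_gap (a t : R) : R := t * mean a t - 2 * cgf a t.

Lemma is_derive_slope_gap (a t : R) :
  0 < a -> is_derive (slope_gap a) t (t * skewness a t).
Proof.
intro ha. unfold slope_gap.
generalize (is_derive_mean a t ha) (is_derive_variance a t ha); intros h1 h2.
auto_derive.
- split; [eexists; exact h2|split; [eexists; exact h1|auto]].
- rewrite (is_derive_unique (fun x : R => mean a x) _ _ h1), (is_derive_unique (fun x : R => variance a x) _ _ h2). ring.
Qed.

Lemma is_derive_chord_gap (a t : R) :
  0 < a -> is_derive (chord_gap a) t (slope_gap a t).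
Proof.
intro ha. unfold chord_gap.
generalize (is_derive_cgf a t ha) (is_derive_mean a t ha); intros h1 h2.
auto_derive.
- split; [eexists; exact h2|split; [eexists; exact h1|auto]].
- rewrite (is_derive_unique (fun x : R => cgf a x) _ _ h1), (is_derive_unique (fun x : R => mean a x) _ _ h2).
  unfold slope_gap. ring.
Qed.

Lemma mean_0 (a : R) : mean a 0 = 0.
Proof. unfold mean. rewrite sinh_0. unfold Rdiv. ring. Qed.

Lemma slope_gap_0 (a : R) : slope_gap a 0 = 0.
Proof. unfold slope_gap. rewrite mean_0. ring. Qed.

Lemma chord_gap_0 (a : R) : chord_gap a 0 = 0.
Proof. unfold chord_gap. rewrite cgf_0. ring. Qed.

(** Since [mean] stays below 1 while [cgf a t] is at least t - C, with [C] as set in the proof, the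
    gap is less than 2C - t for t > 0, hence negative at t = 2C + 1. *)
Lemma chord_gap_eventually_neg (a : R) :
  0 < a -> exists y, 0 < y /\ chord_gap a y < 0.
Proof.
intro ha. set (C := Rabs (ln (a / (1 + 2 * a)))).
assert (hC : - ln (a / (1 + 2 * a)) <= C).
{ unfold C. rewrite <- Rabs_Ropp. apply Rle_abs. }
assert (hC0 : 0 <= C) by apply Rabs_pos.
exists (2 * C + 1). split; [lra|]. unfold chord_gap.
generalize (cgf_lower a (2 * C + 1) ha) (mean_lt_1 a (2 * C + 1) ha). nra.
Qed.

(* The threshold [a < 1 / 4], i.e. [beta > ln 4], makes the mean convex near 0. *)
Lemma skewness_sign (a : R) : 0 < a < / 4 ->
  exists c, 0 < c /\ (forall t, 0 < t < c -> 0 < skewness a t) /\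
    (forall t, c < t -> skewness a t < 0).
Proof.
intros [ha ha4].
assert (hmono : forall s t, 0 <= s < t -> partition a s < partition a t).
{ intros s t hst. apply (strict_incr _ (fun u => 2 * a * sinh u)); [lra| |].
  - intros u _. apply is_derive_partition.
  - intros u hu. assert (0 < sinh u) by (apply sinh_pos; lra). nra. }
assert (ha' : 0 < / a) by (apply Rinv_0_lt_compat; lra).
(* This factor carries the sign of [skewness] for t > 0. At 0 it equals (1 - 4a)(1 + 2a), positive
   because a < 1/4; at 2/a it is negative because exp(x) >= 1 + x makes the partition function
   exceed 2. *)
destruct (zero_crossing (fun t => 2 - 8 * a ^ 2 - partition a t)
  (fun t => - (2 * a * sinh t)) 0 (2 / a)) as [c [hc e]].
- unfold Rdiv. lra.
- intros t _. generalize (is_derive_partition a t); intro hd. auto_derive.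
  + exists (2 * a * sinh t). exact hd.
  + rewrite (is_derive_unique (fun x : R => partition a x) _ _ hd). ring.
- rewrite partition_0. nra.
- unfold partition, cosh.
  generalize (exp_ineq1_le (2 / a)) (exp_pos (- (2 / a))); intros h1 h2.
  assert (a * (1 + 2 / a) = a + 2) by (field; lra). nra.
- exists c. split; [lra|].
  assert (hs : forall t, 0 < t -> 0 < 2 * a * sinh t / partition a t ^ 3).
  { intros t ht. apply Rdiv_lt_0_compat; [generalize (sinh_pos t ht); nra|].
    apply pow_lt, partition_pos, ha. }
  assert (es : forall t, skewness a t
    = 2 * a * sinh t / partition a t ^ 3 * (2 - 8 * a ^ 2 - partition a t)).
  { intro t. unfold skewness, Rdiv. ring. }
  split; intros t ht; rewrite es; assert (ht0 : 0 < t) by lra;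
    specialize (hs t ht0).
  + generalize (hmono t c); nra.
  + generalize (hmono c t). nra.
Qed.

(** [zero_after_peak] is applied twice, from [skewness] to [slope_gap] and from there to
    [chord_gap]. It needs a negative value each time: one is known for [chord_gap], and the mean
    value theorem on [0, y] turns it into one for [slope_gap]. *)
Lemma gap_signs (a : R) : 0 < a < / 4 ->
  exists ts T, 0 < ts < T /\
    (forall t, 0 < t < ts -> 0 < slope_gap a t) /\
    (forall t, ts < t -> slope_gap a t < 0) /\
    chord_gap a T = 0 /\ (forall t, T < t -> chord_gap a t < 0).
Proof.
intros ha. assert (ha0 : 0 < a) by lra.
destruct (skewness_sign a ha) as [c [hc [hup hdown]]].
destruct (chord_gap_eventually_neg a ha0) as [y [hy hqy]].
destruct (mvt (chord_gap a) (slope_gap a) 0 y) as [x [e hx]]; [exact hy| |].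
{ intros t _. apply is_derive_chord_gap, ha0. }
rewrite chord_gap_0 in e.
destruct (zero_after_peak (slope_gap a) (fun t => t * skewness a t) c x)
  as [ts [hts [_ [hpos hneg]]]]; try lra.
{ intro t. apply is_derive_slope_gap, ha0. }
{ apply slope_gap_0. }
{ intros t ht. specialize (hup t ht). nra. }
{ intros t ht. specialize (hdown t ht). nra. }
{ nra. }
destruct (zero_after_peak (chord_gap a) (slope_gap a) ts y)
  as [T [hT [hT0 [_ hTneg]]]]; try lra; auto.
{ intro t. apply is_derive_chord_gap, ha0. }
{ apply chord_gap_0. }
exists ts, T. repeat split; auto; lra.
Qed.

(** * Unimodality of the slope *)

Definition slope (a t : R) : R := mean a t / t.

Lemma is_derive_slope (a t : R) :
  0 < a -> t <> 0 -> is_derive (slope a) t (slope_gap a t / t ^ 2).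
Proof.
intros ha ht. unfold slope. evar_last.
- apply is_derive_div; [apply is_derive_mean, ha|apply is_derive_id|exact ht].
- unfold slope_gap, one; simpl. field. exact ht.
Qed.

Lemma slope_pos (a t : R) : 0 < a -> 0 < t -> 0 < slope a t.
Proof. intros ha ht. apply Rdiv_lt_0_compat; [apply mean_pos|]; auto. Qed.

Lemma slope_lt_inv (a t : R) : 0 < a -> 0 < t -> slope a t < / t.
Proof.
intros ha ht. unfold slope, Rdiv. rewrite <- (Rmult_1_l (/ t)) at 2.
apply Rmult_lt_compat_r; [apply Rinv_0_lt_compat, ht|apply mean_lt_1, ha].
Qed.

Lemma slope_unimodal (a : R) : 0 < a < / 4 ->
  exists ts T, 0 < ts < T /\
    (forall s t, 0 < s < t -> t <= ts -> slope a s < slope a t) /\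
    (forall s t, ts <= s < t -> slope a t < slope a s) /\
    chord_gap a T = 0 /\ (forall t, T < t -> chord_gap a t < 0).
Proof.
intro ha. destruct (gap_signs a ha) as [ts [T [hT [hup [hdown hq]]]]].
exists ts, T. split; [exact hT|]. split; [|split; [|exact hq]].
- intros s t hst htts. apply (strict_incr _ (fun u => slope_gap a u / u ^ 2)); [lra| |].
  + intros u hu. apply is_derive_slope; lra.
  + intros u hu. apply Rdiv_lt_0_compat; [apply hup; lra|apply pow_lt; lra].
- intros s t hst. apply (strict_decr _ (fun u => slope_gap a u / u ^ 2)); [lra| |].
  + intros u hu. apply is_derive_slope; lra.
  + intros u hu. assert (0 < - slope_gap a u / u ^ 2).
    { apply Rdiv_lt_0_compat; [specialize (hdown u); lra|apply pow_lt; lra]. }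
    unfold Rdiv in *. lra.
Qed.

(** * Global minimizers of the dual energy *)

Definition dual_energy (a l t : R) : R := l * t ^ 2 - cgf a t.

Lemma dual_energy_opp (a l t : R) : dual_energy a l (- t) = dual_energy a l t.
Proof. unfold dual_energy, cgf. rewrite partition_opp. ring. Qed.

Lemma dual_energy_0 (a l : R) : dual_energy a l 0 = 0.
Proof. unfold dual_energy. rewrite cgf_0. ring. Qed.

(** Writing the quadratic coefficient as [v / 2] factors the derivative, so that for t > 0 its sign
    is decided by comparing [slope a t] with [v]. *)
Lemma is_derive_dual_energy (a v t : R) : 0 < a ->
  is_derive (dual_energy a (v / 2)) t (t * (v - slope a t)).
Proof.
intros ha. generalize (is_derive_cgf a t ha); intro hd.
unfold dual_energy. auto_derive.
- eexists. exact hd.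
- rewrite (is_derive_unique (fun x : R => cgf a x) _ _ hd). unfold slope.
  (* At t = 0 the quotient [slope a 0] is a division by zero, harmless behind the factor t. *)
  destruct (Req_dec t 0) as [->|ht]; [rewrite mean_0; ring|field; exact ht].
Qed.

(** With this coefficient t is a critical point, so the sign of [chord_gap] tells whether it beats
    the energy 0 at the origin; a zero of [chord_gap] is a tie. *)
Lemma dual_energy_at_slope (a t : R) : t <> 0 ->
  dual_energy a (slope a t / 2) t = chord_gap a t / 2.
Proof. intro ht. unfold dual_energy, slope, chord_gap. field. exact ht. Qed.

(** For v = [slope a tau], the energy decreases on [ts, tau] and increases beyond tau, by
    monotonicity of the slope past its peak ts. Below ts it can only rise and then fall, so the
    remaining competitor is 0, handled by [chord_gap]. The final disjunction excludes the tie
    between 0 and T. *)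
Lemma dual_minimizers (a : R) : 0 < a < / 4 ->
  exists T, 0 < T /\
    (forall s t, T <= s < t -> slope a t < slope a s) /\
    dual_energy a (slope a T / 2) T = 0 /\
    (forall tau t, T <= tau -> 0 <= t -> t <> tau -> 0 < t \/ T < tau ->
      dual_energy a (slope a tau / 2) tau < dual_energy a (slope a tau / 2) t).
Proof.
intro ha. assert (ha0 : 0 < a) by lra.
destruct (slope_unimodal a ha) as [ts [T [hT [hup [hdown [hq0 hq]]]]]].
exists T. split; [lra|]. split; [intros s t hst; apply hdown; lra|]. split.
{ rewrite dual_energy_at_slope; lra. }
intros tau t htau ht hne hcase.
set (D := dual_energy a (slope a tau / 2)).
set (D' := fun u => u * (slope a tau - slope a u)).
assert (hD : forall u, is_derive D u (D' u)).
{ intro u. apply is_derive_dual_energy, ha0. }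
assert (hD0 : D tau <= D 0).
{ unfold D. rewrite dual_energy_0, dual_energy_at_slope by lra.
  destruct (Req_dec tau T) as [->|e]; [lra|]. specialize (hq tau). lra. }
assert (hleft : forall s, ts <= s < tau -> D tau < D s).
{ intros s hs. apply (strict_decr D D'); [lra|auto|].
  intros u hu. unfold D'. specialize (hdown u tau). nra. }
destruct (Rlt_le_dec tau t) as [hgt|hle].
{ apply (strict_incr D D'); [lra|auto|].
  intros u hu. unfold D'. specialize (hdown tau u). nra. }
destruct (Rle_lt_dec ts t) as [hge|hlt]; [apply hleft; lra|].
destruct (Req_dec t 0) as [->|ht0].
{ unfold D. rewrite dual_energy_0, dual_energy_at_slope by lra.
  specialize (hq tau). lra. }
(* The slope increases on (0, ts]: either the energy has been increasing all the way from 0 to t, or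
   it decreases all the way from t to ts. *)
destruct (Rle_lt_dec (slope a t) (slope a tau)) as [hs|hs].
- apply Rle_lt_trans with (D 0); [exact hD0|].
  apply (strict_incr D D'); [lra|auto|].
  intros u hu. unfold D'. specialize (hup u t). nra.
- apply Rlt_trans with (D ts); [apply hleft; lra|].
  apply (strict_decr D D'); [lra|auto|].
  intros u hu. unfold D'. specialize (hup t u). nra.
Qed.

(** The bound slope < 1/t shows that the slope has dropped below v by t = 1/v, and at T it shows T <
    1/v, so the intermediate value theorem applies on [T, 1/v]. *)
Lemma slope_surjective (a T v : R) : 0 < a -> 0 < T -> 0 < v <= slope a T ->
  exists t, T <= t /\ slope a t = v.
Proof.
intros ha hT [hv hvT]. destruct (Req_dec v (slope a T)) as [e|e].
{ exists T. split; lra. }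
assert (hiv : 0 < / v) by apply Rinv_0_lt_compat, hv.
assert (hT' : T < / v).
{ rewrite <- (Rinv_inv T). apply Rinv_lt_contravar.
  - apply Rmult_lt_0_compat; [exact hv|apply Rinv_0_lt_compat, hT].
  - generalize (slope_lt_inv a T ha hT). lra. }
destruct (zero_crossing (fun t => slope a t - v)
  (fun t => slope_gap a t / t ^ 2) T (/ v) hT') as [t [ht et]].
- intros t ht. evar_last.
  + apply @is_derive_minus; [apply is_derive_slope; lra|apply @is_derive_const].
  + unfold minus, plus, opp, zero; simpl. ring.
- lra.
- generalize (slope_lt_inv a (/ v) ha hiv). rewrite Rinv_inv. lra.
- exists t. split; lra.
Qed.

(** * The exponentially tilted measures *)

Definition gibbs (beta t : R) : Lambda -> R :=
  fun i => exp (- beta * spin i ^ 2 + t * spin i) / partition (exp (- beta)) t.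

Lemma gibbs_pos (beta t : R) (i : Lambda) : 0 < gibbs beta t i.
Proof. apply Rdiv_lt_0_compat; [|apply partition_pos]; apply exp_pos. Qed.

Lemma gibbs_zero (beta t : R) :
  gibbs beta t Lzero = / partition (exp (- beta)) t.
Proof.
unfold gibbs, spin. replace (_ + _) with 0 by ring. rewrite exp_0. apply Rmult_1_l.
Qed.

Lemma gibbs_pm (beta t : R) :
  gibbs beta t Lpos = exp (- beta) * exp t / partition (exp (- beta)) t /\
  gibbs beta t Lneg = exp (- beta) * exp (- t) / partition (exp (- beta)) t.
Proof.
unfold gibbs, spin. rewrite <- !exp_plus. split; do 2 f_equal; ring.
Qed.

Lemma is_prob_gibbs (beta t : R) : is_prob (gibbs beta t).
Proof.
split; [intro i; apply Rlt_le, gibbs_pos|].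
unfold sum_Lambda. destruct (gibbs_pm beta t) as [-> ->]. rewrite gibbs_zero.
generalize (partition_pos (exp (- beta)) t (exp_pos _)).
unfold partition, cosh. intro h. field. lra.
Qed.

Lemma Lambda_ext (mu nu : Lambda -> R) :
  mu Lneg = nu Lneg -> mu Lzero = nu Lzero -> mu Lpos = nu Lpos -> mu = nu.
Proof. intros. apply functional_extensionality. intros []; assumption. Qed.

Lemma gibbs_0 (beta : R) : gibbs beta 0 = rho_beta beta.
Proof.
assert (e : Defs.Z beta = partition (exp (- beta)) 0 / 3).
{ unfold Defs.Z, integral, sum_Lambda, rho, spin.
  replace (- beta * (-1) ^ 2) with (- beta) by ring.
  replace (- beta * 0 ^ 2) with 0 by ring.
  replace (- beta * 1 ^ 2) with (- beta) by ring.
  rewrite exp_0, partition_0. field. }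
generalize (partition_pos (exp (- beta)) 0 (exp_pos _)); intro h.
apply functional_extensionality. intro i. unfold gibbs, rho_beta, rho.
rewrite e, Rmult_0_l, Rplus_0_r. field. lra.
Qed.

(** The mass at 0 recovers the partition function, after which the mass at 1 recovers exp(t). *)
Lemma gibbs_inj (beta s t : R) : gibbs beta s = gibbs beta t -> s = t.
Proof.
intro e. assert (e0 := f_equal (fun mu => mu Lzero) e).
assert (e1 := f_equal (fun mu => mu Lpos) e). simpl in e0, e1.
rewrite !gibbs_zero in e0. destruct (gibbs_pm beta s) as [e2 _].
destruct (gibbs_pm beta t) as [e3 _]. rewrite e2, e3 in e1.
unfold Rdiv in e1. rewrite e0 in e1.
apply exp_inv, Rmult_eq_reg_l with (exp (- beta)); [|apply Rgt_not_eq, exp_pos].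
apply Rmult_eq_reg_r with (2 := Rgt_not_eq _ _ (Rinv_0_lt_compat _
  (partition_pos (exp (- beta)) t (exp_pos _)))). exact e1.
Qed.

Lemma gibbs_flip (beta t : R) (i : Lambda) :
  gibbs beta (- t) i = gibbs beta t (flip i).
Proof.
unfold gibbs. rewrite partition_opp. do 2 f_equal. destruct i; simpl; ring.
Qed.

(** * Relative entropy and reduction to the dual energy *)

Definition kullback (mu nu : Lambda -> R) : R :=
  sum_Lambda (fun i => mu i * (ln (mu i) - ln (nu i))).

(** This is 1 + ln u <= u at u = p/x, strict unless u = 1. Summed over two probability measures, the
    terms x - p cancel, which gives the Gibbs inequality with its equality case. *)
Lemma xlnx_gap (x p : R) : 0 <= x -> 0 < p ->
  x - p <= x * (ln x - ln p) /\ (x <> p -> x - p < x * (ln x - ln p)).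
Proof.
intros hx hp. assert (strict : x <> p -> x - p < x * (ln x - ln p)).
{ intro hne. destruct (Req_dec x 0) as [->|hx0]; [lra|].
  assert (hx' : 0 < x) by lra.
  assert (hpx : 0 < p / x) by (apply Rdiv_lt_0_compat; lra).
  assert (h : 1 + ln (p / x) < p / x).
  { rewrite <- (exp_ln (p / x)) at 2 by exact hpx. apply exp_ineq1.
    intro e. rewrite <- ln_1 in e. apply ln_inv in e; try lra.
    apply hne. apply Rmult_eq_reg_r with (/ x); [|apply Rinv_neq_0_compat; lra].
    rewrite Rinv_r by lra. symmetry. exact e. }
  rewrite ln_div in h by lra.
  assert (x * (1 + (ln p - ln x)) < x * (p / x)) by (apply Rmult_lt_compat_l; lra).
  assert (x * (p / x) = p) by (field; lra). lra. }
split; [|exact strict].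
destruct (Req_dec x p) as [->|hne]; [lra|]. apply Rlt_le, strict, hne.
Qed.

Lemma kullback_refl (mu : Lambda -> R) : kullback mu mu = 0.
Proof. unfold kullback, sum_Lambda. ring. Qed.

Lemma kullback_pos (mu nu : Lambda -> R) :
  is_prob mu -> is_prob nu -> (forall i, 0 < nu i) ->
  0 <= kullback mu nu /\ (kullback mu nu = 0 -> mu = nu).
Proof.
intros [hmu smu] [_ snu] hnu. unfold kullback, sum_Lambda in *.
destruct (xlnx_gap (mu Lneg) (nu Lneg)) as [h1 h1']; auto.
destruct (xlnx_gap (mu Lzero) (nu Lzero)) as [h2 h2']; auto.
destruct (xlnx_gap (mu Lpos) (nu Lpos)) as [h3 h3']; auto.
split; [lra|]. intro e. apply Lambda_ext; apply NNPP; intro hne.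
- specialize (h1' hne). lra.
- specialize (h2' hne). lra.
- specialize (h3' hne). lra.
Qed.

(** Expanding the logarithm of the tilted density leaves t m - beta K m^2 with m = mu_1 - mu_{-1};
    completing the square in m produces t^2 / (4 beta K) and the subtracted square. The tilt t is
    free. *)
Lemma free_energy_decomposition (beta K t : R) (mu : Lambda -> R) :
  0 < beta -> 0 < K -> is_prob mu ->
  rel_entropy mu + beta * Defs.f K mu =
  kullback mu (gibbs beta t)
  + dual_energy (exp (- beta)) (/ (4 * beta * K)) t
  - (t - 2 * beta * K * (mu Lpos - mu Lneg)) ^ 2 / (4 * beta * K)
  + (ln 3 - ln (partition (exp (- beta)) 0)).
Proof.
intros hb hK [hmu smu].
assert (e3 : forall x, 0 <= x -> x * ln (3 * x) = x * ln 3 + x * ln x).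
{ intros x hx. destruct (Req_dec x 0) as [->|hx0]; [ring|].
  rewrite ln_mult by lra. ring. }
assert (eg : forall i, ln (gibbs beta t i)
  = - beta * spin i ^ 2 + t * spin i - ln (partition (exp (- beta)) t)).
{ intro i. unfold gibbs. rewrite ln_div, ln_exp; [reflexivity|apply exp_pos|].
  apply partition_pos, exp_pos. }
unfold rel_entropy, kullback, Defs.f, integral, dual_energy, cgf, sum_Lambda in *.
rewrite !e3, !eg by auto. unfold spin.
replace (mu Lzero) with (1 - mu Lneg - mu Lpos) at 1 3 by lra.
replace (mu Lzero) with (1 - mu Lneg - mu Lpos) by lra.
field. lra.
Qed.

(** Two choices in the decomposition: t = [tilt mu] kills the square and bounds the free energy
    below by the dual energy, while mu = [gibbs beta t] kills the divergence and bounds it above.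
    For a minimizer the divergence must then vanish, forcing nu = [gibbs beta (tilt nu)]. *)
Lemma macrostates_gibbs (beta K : R) (nu : Lambda -> R) : 0 < beta -> 0 < K ->
  macrostates beta K nu <->
  exists t, nu = gibbs beta t /\ forall s,
    dual_energy (exp (- beta)) (/ (4 * beta * K)) t
    <= dual_energy (exp (- beta)) (/ (4 * beta * K)) s.
Proof.
intros hb hK. set (H := dual_energy (exp (- beta)) (/ (4 * beta * K))).
assert (hc : 0 < / (4 * beta * K)) by (apply Rinv_0_lt_compat; nra).
set (tilt := fun mu : Lambda -> R => 2 * beta * K * (mu Lpos - mu Lneg)).
set (C := ln 3 - ln (partition (exp (- beta)) 0)).
assert (self : forall mu, is_prob mu -> rel_entropy mu + beta * Defs.f K mu
  = kullback mu (gibbs beta (tilt mu)) + H (tilt mu) + C).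
{ intros mu hmu. rewrite (free_energy_decomposition beta K (tilt mu)) by assumption.
  fold H C. unfold tilt. unfold Rdiv. ring. }
assert (upper : forall t, rel_entropy (gibbs beta t) + beta * Defs.f K (gibbs beta t)
  <= H t + C).
{ intro t. rewrite (free_energy_decomposition beta K t) by
    (auto using is_prob_gibbs).
  fold H C. rewrite kullback_refl. unfold Rdiv.
  generalize (pow2_ge_0 (t - 2 * beta * K * (gibbs beta t Lpos - gibbs beta t Lneg))).
  nra. }
split.
- intros [hnu hmin]. exists (tilt nu).
  destruct (kullback_pos nu (gibbs beta (tilt nu)) hnu) as [hk hk0].
  { apply is_prob_gibbs. }
  { apply gibbs_pos. }
  assert (hle : forall s, kullback nu (gibbs beta (tilt nu)) + H (tilt nu) <= H s).
  { intro s. generalize (hmin _ (is_prob_gibbs beta s)) (upper s).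
    rewrite (self nu hnu). lra. }
  split; [apply hk0; specialize (hle (tilt nu)); lra|].
  intro s. specialize (hle s). lra.
- intros [t [-> ht]]. split; [apply is_prob_gibbs|]. intros mu hmu.
  rewrite (self mu hmu).
  destruct (kullback_pos mu (gibbs beta (tilt mu)) hmu) as [hk _].
  { apply is_prob_gibbs. }
  { apply gibbs_pos. }
  generalize (upper t) (ht (tilt mu)). lra.
Qed.

(** * Continuity of the inverse branch and of the tilted measures *)

(** Strict monotonicity traps [tau x] within eps of [tau k] once x lies between the values of
    [kappa] at [tau k - eps] and [tau k + eps]. *)
Lemma inverse_continuous (kappa tau : R -> R) (T k0 : R) :
  (forall s t, T <= s < t -> kappa s < kappa t) ->
  (forall k, k0 <= k -> T <= tau k /\ kappa (tau k) = k) ->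
  forall k, k0 <= k ->
  filterlim tau (within (fun x => k0 <= x) (locally k)) (locally (tau k)).
Proof.
intros hincr htau k hk. apply filterlim_locally. intro eps.
destruct (htau k hk) as [hT ek].
assert (heps := cond_pos eps).
assert (hR : k < kappa (tau k + eps)).
{ rewrite <- ek at 1. apply hincr. lra. }
assert (above : locally k (fun x => x < kappa (tau k + eps))).
{ apply (open_lt (kappa (tau k + eps))). exact hR. }
(* Left of T nothing is known about [kappa], but there [T <= tau x] already gives the lower
   bound. *)
assert (below : locally k (fun x => tau k - eps < T \/ kappa (tau k - eps) < x)).
{ destruct (Rlt_le_dec (tau k - eps) T) as [h|h].
  - apply filter_forall. intro x. left. exact h.
  - eapply filter_imp; [intros x hx; right; exact hx|].
    apply (open_gt (kappa (tau k - eps))).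
    rewrite <- ek at 2. apply hincr. lra. }
unfold within. generalize (filter_and _ _ above below). apply filter_imp.
intros x [ha hb] hx. destruct (htau x hx) as [hTx ex].
apply Rabs_def1.
- unfold minus, plus, opp; simpl.
  destruct (Rlt_le_dec (tau x) (tau k + eps)) as [h|h]; [lra|].
  destruct h as [h|h]; [specialize (hincr (tau k + eps) (tau x)); lra|].
  rewrite h, ex in ha. lra.
- unfold minus, plus, opp; simpl.
  destruct (Rlt_le_dec (tau k - eps) (tau x)) as [h|h]; [lra|].
  destruct hb as [hb|hb]; [lra|].
  destruct h as [h|h]; [specialize (hincr (tau x) (tau k - eps)); lra|].
  rewrite <- h, ex in hb. lra.
Qed.

Lemma continuous_gibbs (beta t : R) : continuous (gibbs beta) t.
Proof.
apply filterlim_locally. intro eps.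
assert (h : forall i, locally t (fun s => ball (gibbs beta t i) eps (gibbs beta s i))).
{ intro i. apply (proj1 (filterlim_locally (fun s => gibbs beta s i) (gibbs beta t i))).
  apply (ex_derive_continuous (fun s => gibbs beta s i)).
  unfold gibbs. generalize (is_derive_partition (exp (- beta)) t); intro hd.
  auto_derive. repeat split.
  - eexists. exact hd.
  - apply Rgt_not_eq, partition_pos, exp_pos. }
generalize (filter_and _ _ (h Lneg) (filter_and _ _ (h Lzero) (h Lpos))).
apply filter_imp. intros s [h1 [h2 h3]] []; assumption.
Qed.

(** * The critical value of K and the bifurcation *)

Theorem theorem3p2 (beta : R) (hbeta : ln 4 < beta) :
  exists Kc : R, 0 < Kc /\
  (* (a)(i) *)
  (forall K, 0 < K < Kc ->
     forall nu, macrostates beta K nu <-> nu = rho_beta beta) /\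
  exists nup num : R -> Lambda -> R,
  (* (a)(ii) *)
  (is_prob (nup Kc) /\ is_prob (num Kc) /\
   nup Kc <> num Kc /\ nup Kc <> rho_beta beta /\ num Kc <> rho_beta beta /\
   forall nu, macrostates beta Kc nu <->
     (nu = rho_beta beta \/ nu = nup Kc \/ nu = num Kc)) /\
  (* (a)(iii) *)
  (forall K, Kc < K ->
     is_prob (nup K) /\ is_prob (num K) /\
     nup K <> num K /\ nup K <> rho_beta beta /\ num K <> rho_beta beta /\
     forall nu, macrostates beta K nu <-> (nu = nup K \/ nu = num K)) /\
  (* (b) *)
  (forall K, Kc <= K -> forall i, num K i = nup K (flip i)) /\
  (* (c) *)
  (forall K, Kc <= K ->
     filterlim nup (within (fun x => Kc <= x) (locally K)) (locally (nup K)) /\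
     filterlim num (within (fun x => Kc <= x) (locally K)) (locally (num K))) /\
  (filterlim nup (at_right Kc) (locally (nup Kc)) /\ nup Kc <> rho_beta beta) /\
  (filterlim num (at_right Kc) (locally (num Kc)) /\ num Kc <> rho_beta beta).
Proof.
assert (hb : 0 < beta) by (generalize (ln_increasing 1 4); rewrite ln_1; lra).
set (a := exp (- beta)).
assert (ha : 0 < a < / 4).
{ split; [apply exp_pos|]. unfold a.
  rewrite <- (exp_ln 4), <- exp_Ropp by lra. apply exp_increasing. lra. }
assert (ha0 : 0 < a) by apply ha.
destruct (dual_minimizers a ha) as [T [hT [hdecr [hDT hmin]]]].
(* The value of K for which t is a critical point; it increases on [T, oo), and [kappa T] is the
   critical K. *)
set (kappa := fun t => / (2 * beta * slope a t)).
assert (hslope : forall t, T <= t -> 0 < slope a t).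
{ intros t ht. apply slope_pos; lra. }
assert (hkincr : forall s t, T <= s < t -> kappa s < kappa t).
{ intros s t hst. unfold kappa.
  assert (h1 := hslope s). assert (h2 := hslope t). assert (h3 := hdecr s t hst).
  apply Rinv_lt_contravar; [|apply Rmult_lt_compat_l; lra].
  apply Rmult_lt_0_compat; apply Rmult_lt_0_compat; lra. }
assert (hkT : 0 < kappa T).
{ apply Rinv_0_lt_compat. generalize (hslope T). nra. }
(* The guard sits inside the existential so that choice yields a total function of K; below
   [kappa T] its value is arbitrary. *)
assert (hex : forall K, exists t, kappa T <= K -> T <= t /\ kappa t = K).
{ intro K. destruct (Rlt_le_dec K (kappa T)) as [hK|hK]; [exists 0; lra|].
  destruct (slope_surjective a T (/ (2 * beta * K)) ha0 hT) as [t [ht et]].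
  - split; [apply Rinv_0_lt_compat; nra|].
    assert (hs := hslope T (Rle_refl T)).
    replace (slope a T) with (/ (2 * beta * kappa T)).
    + apply Rinv_le_contravar; nra.
    + unfold kappa. field. lra.
  - exists t. intros _. split; [exact ht|]. unfold kappa. rewrite et. field. lra. }
set (tau := fun K => proj1_sig (constructive_indefinite_description _ (hex K))).
assert (htau : forall K, kappa T <= K -> T <= tau K /\ kappa (tau K) = K).
{ intro K. exact (proj2_sig (constructive_indefinite_description _ (hex K))). }
assert (htauT : tau (kappa T) = T).
{ destruct (htau (kappa T)) as [h1 h2]; [lra|].
  destruct h1 as [h1|h1]; [|auto].
  specialize (hkincr T (tau (kappa T))). lra. }
assert (hmult : forall K, kappa T <= K -> / (4 * beta * K) = slope a (tau K) / 2).
{ intros K hK. destruct (htau K hK) as [h1 h2].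
  rewrite <- h2 at 1. unfold kappa. field. generalize (hslope _ h1). lra. }
assert (hmin' : forall K t, kappa T <= K -> t <> tau K -> t <> - tau K ->
  t <> 0 \/ kappa T < K ->
  dual_energy a (/ (4 * beta * K)) (tau K) < dual_energy a (/ (4 * beta * K)) t).
{ intros K t hK h1 h2 h3. rewrite (hmult K hK). destruct (htau K hK) as [h4 h5].
  assert (hTtau : kappa T < K -> T < tau K).
  { intro h. destruct h4 as [h4|h4]; [exact h4|]. rewrite <- h4 in h5. lra. }
  destruct (Rle_lt_dec 0 t) as [ht|ht].
  - apply hmin; lra.
  - rewrite <- (dual_energy_opp a _ t). apply hmin; lra. }
assert (eqK : forall K nu, kappa T < K ->
  macrostates beta K nu <-> nu = gibbs beta (tau K) \/ nu = gibbs beta (- tau K)).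
{ intros K nu hK. rewrite (macrostates_gibbs beta K nu hb) by lra. fold a. split.
  - intros [t [-> ht]].
    destruct (Req_dec t (tau K)) as [->|h1]; [left; reflexivity|].
    destruct (Req_dec t (- tau K)) as [->|h2]; [right; reflexivity|].
    specialize (ht (tau K)). specialize (hmin' K t). lra.
  - assert (h : forall s, dual_energy a (/ (4 * beta * K)) (tau K)
      <= dual_energy a (/ (4 * beta * K)) s).
    { intro s. destruct (Req_dec s (tau K)) as [->|h1]; [lra|].
      destruct (Req_dec s (- tau K)) as [->|h2]; [rewrite dual_energy_opp; lra|].
      specialize (hmin' K s). lra. }
    intros [->| ->]; eexists; (split; [reflexivity|]); [exact h|].
    rewrite dual_energy_opp. exact h. }
assert (hmc : / (4 * beta * kappa T) = slope a T / 2).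
{ rewrite hmult, htauT; lra. }
(* By [hDT] the energies at T and -T tie with the value 0 at the origin, so the minimum is 0 and is
   attained at these three points only. *)
assert (hcrit : forall t, 0 <= dual_energy a (/ (4 * beta * kappa T)) t
  /\ (t <> 0 -> t <> T -> t <> - T -> 0 < dual_energy a (/ (4 * beta * kappa T)) t)).
{ intro t.
  assert (h : t <> 0 -> t <> T -> t <> - T ->
    0 < dual_energy a (/ (4 * beta * kappa T)) t).
  { intros h1 h2 h3. specialize (hmin' (kappa T) t). rewrite htauT, hmc, hDT in hmin'.
    rewrite hmc. apply hmin'; auto; lra. }
  split; [|exact h].
  destruct (Req_dec t 0) as [->|h1]; [rewrite dual_energy_0; lra|].
  destruct (Req_dec t T) as [->|h2]; [rewrite hmc; lra|].
  destruct (Req_dec t (- T)) as [->|h3]; [rewrite hmc, dual_energy_opp; lra|].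
  apply Rlt_le; auto. }
assert (eqc : forall nu, macrostates beta (kappa T) nu <->
  nu = rho_beta beta \/ nu = gibbs beta T \/ nu = gibbs beta (- T)).
{ intro nu. rewrite (macrostates_gibbs beta (kappa T) nu hb hkT). fold a.
  rewrite <- gibbs_0. split.
  - intros [t [-> ht]]. specialize (ht 0). rewrite dual_energy_0 in ht.
    destruct (Req_dec t 0) as [->|h1]; [auto|].
    destruct (Req_dec t T) as [->|h2]; [auto|].
    destruct (Req_dec t (- T)) as [->|h3]; [auto|].
    destruct (hcrit t) as [_ h]. specialize (h h1 h2 h3). lra.
  - intros [->|[->| ->]]; eexists; (split; [reflexivity|]); intro s;
      rewrite ?dual_energy_opp, ?dual_energy_0; [|rewrite hmc at 1; rewrite hDT..];
      apply hcrit. }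
assert (eqsub : forall K nu, 0 < K < kappa T ->
  macrostates beta K nu <-> nu = rho_beta beta).
{ intros K nu hK. rewrite (macrostates_gibbs beta K nu hb) by lra. fold a.
  rewrite <- gibbs_0.
  (* Lowering K below [kappa T] raises the coefficient of t^2, which adds a strictly positive amount
     to the nonnegative critical energy. *)
  assert (h : forall t, t <> 0 -> 0 < dual_energy a (/ (4 * beta * K)) t).
  { intros t ht. destruct (hcrit t) as [h _]. apply Rle_lt_trans with (1 := h).
    unfold dual_energy. apply Rplus_lt_compat_r, Rmult_lt_compat_r.
    - apply pow2_gt_0, ht.
    - apply Rinv_lt_contravar; [|apply Rmult_lt_compat_l; lra].
      repeat apply Rmult_lt_0_compat; lra. }
  split.
  - intros [t [-> ht]]. destruct (Req_dec t 0) as [->|h1]; [reflexivity|].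
    specialize (ht 0). rewrite dual_energy_0 in ht. specialize (h t h1). lra.
  - intros ->. exists 0. split; [reflexivity|]. intro s. rewrite dual_energy_0.
    destruct (Req_dec s 0) as [->|h1]; [rewrite dual_energy_0; lra|].
    apply Rlt_le, h, h1. }
assert (distinct : forall K, kappa T <= K ->
  gibbs beta (tau K) <> gibbs beta (- tau K) /\
  gibbs beta (tau K) <> rho_beta beta /\ gibbs beta (- tau K) <> rho_beta beta).
{ intros K hK. destruct (htau K hK) as [h _]. rewrite <- gibbs_0.
  repeat split; intro e; apply gibbs_inj in e; lra. }
assert (ctau := inverse_continuous kappa tau T (kappa T) hkincr htau).
assert (cplus : forall K, kappa T <= K ->
  filterlim (fun k => gibbs beta (tau k))
    (within (fun x => kappa T <= x) (locally K)) (locally (gibbs beta (tau K)))).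
{ intros K hK. eapply filterlim_comp; [apply ctau, hK|apply continuous_gibbs]. }
assert (cminus : forall K, kappa T <= K ->
  filterlim (fun k => gibbs beta (- tau k))
    (within (fun x => kappa T <= x) (locally K)) (locally (gibbs beta (- tau K)))).
{ intros K hK. eapply filterlim_comp; [|apply continuous_gibbs].
  eapply filterlim_comp; [apply ctau, hK|apply (filterlim_opp (tau K))]. }
(* The right limit at the critical K is thus a case of continuity on the closed half-line. *)
assert (hright : filter_le (at_right (kappa T))
  (within (fun x => kappa T <= x) (locally (kappa T)))).
{ intro P. unfold at_right, within. apply filter_imp.
  intros x hx h. apply hx, Rlt_le, h. }
destruct (distinct (kappa T) (Rle_refl _)) as [d1 [d2 d3]].
exists (kappa T). split; [exact hkT|]. split; [intros K hK nu; apply eqsub, hK|].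
exists (fun K => gibbs beta (tau K)), (fun K => gibbs beta (- tau K)).
split; [|split; [|split; [|split; [|split]]]].
- do 2 (split; [apply is_prob_gibbs|]). do 3 (split; [assumption|]).
  rewrite htauT. exact eqc.
- intros K hK. destruct (distinct K (Rlt_le _ _ hK)) as [e1 [e2 e3]].
  do 2 (split; [apply is_prob_gibbs|]). do 3 (split; [assumption|]).
  intro nu. apply eqK, hK.
- intros K _ i. apply gibbs_flip.
- intros K hK. split; [apply cplus, hK|apply cminus, hK].
- split; [|exact d2].
  apply filterlim_filter_le_1 with (1 := hright), cplus, Rle_refl.
- split; [|exact d3].
  apply filterlim_filter_le_1 with (1 := hright), cminus, Rle_refl.
Qed.
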